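(* Let $A$ be an algebra over a field $\mathbb F$. Then $A$ is a GKŻ algebra under each of the following conditions: (1) $A\setminus\mathcal U(A)$ is contained in a union of at most two proper one-sided ideals of $A$. (2) $\mathbb F$ is infinite, and $A\setminus\mathcal U(A)$ is contained in a union of less than $|\mathbb F|$ proper one-sided ideals of $A$. (3) $\mathbb F$ is infinite, and $A\setminus\mathcal U(A)$ is contained in a union of finitely many proper one-sided ideals of $A$.
   Context: All algebras are nonzero, associative, unital, not necessarily commutative. $\mathcal U(A)$ denotes the group of units of $A$. A unital algebra $A$ over a field $\mathbb F$ is a GKŻ algebra if every linear functional $\Lambda:A\to\mathbb F$ such that $\Lambda(u)\neq0$ for all $u\in\mathcal U(A)$ and $\Lambda(\mathbf 1_A)=1$ is multiplicative. A one-sided ideal is a left ideal or a right ideal; the ideals in a union may be of both kinds. Proper means different from $A$. $|\mathbb F|$ denotes cardinality. *)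

(* Defs.v *)
From HB Require Import structures.
From mathcomp Require Import all_boot all_order all_algebra.
From mathcomp Require Import mathcomp_extra boolp classical_sets functions.
From mathcomp Require Import cardinality.

Set Implicit Arguments.
Unset Strict Implicit.
Unset Printing Implicit Defensive.

Import GRing.Theory.

Local Open Scope classical_set_scope.
Local Open Scope ring_scope.

(* The order on cardinals is total, so this is [S] < [T] for cardinals. *)
Definition card_lt (S T : Type) (X : set S) (Y : set T) : Prop :=
  (X #<= Y)%card /\ ~ (Y #<= X)%card.

(* A [unitAlgType] is nonzero, since every [unitRingType] satisfies 1 != 0.
   Its units are exactly the two-sided invertible elements ([unitrP]). *)
Definition GKZ_algebra (F : fieldType) (A : unitAlgType F) : Prop :=
  forall L : {scalar A},
    (forall u : A, u \is a GRing.unit -> L u != 0) -> L 1 = 1 ->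
    forall x y : A, L (x * y) = L x * L y.

(* Closure under scalars is automatic, as c *: x = (c *: 1) * x = x * (c *: 1).
   The library's [idealr_closed] covers left ideals only, and has properness
   built in. *)
Definition left_ideal (R : nzRingType) (J : set R) : Prop :=
  [/\ J 0,
      forall x y : R, J x -> J y -> J (x - y)
    & forall a x : R, J x -> J (a * x)].

Definition right_ideal (R : nzRingType) (J : set R) : Prop :=
  [/\ J 0,
      forall x y : R, J x -> J y -> J (x - y)
    & forall a x : R, J x -> J (x * a)].

Definition proper_one_sided_ideal (R : nzRingType) (J : set R) : Prop :=
  (left_ideal J \/ right_ideal J) /\ J <> setT.

Definition nonunits_covered_by (F : fieldType) (A : unitAlgType F)
    (C : set (set A)) : Prop :=
  (forall J : set A, C J -> proper_one_sided_ideal J) /\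
  [set x : A | x \isn't a GRing.unit] `<=` \bigcup_(J in C) J.

(* Main.v *)
(* Let N be the kernel of a functional L that does not vanish on units and has
   L 1 = 1. Then N consists of nonunits, so it is covered by the given ideals,
   which are linear subspaces. A line of vectors x + t *: y has more members
   than there are ideals (for two ideals over an arbitrary field, take x, y and
   x + y instead), so two of them fall in the same ideal, which then
   contains x and y; iterating, any three vectors of N lie in a common ideal.
   For x, y in N apply this to x, y and x * y - L (x * y) *: 1: the common
   ideal, left or right, contains x * y, hence L (x * y) *: 1, and since it is
   proper L (x * y) = 0. Only three-dimensional subspaces of N are used because
   an infinite-dimensional space over an uncountable field can be a countable
   union of proper subspaces. *)
Require Import Defs.
From HB Require Import structures.
From mathcomp Require Import all_boot all_order all_algebra.
From mathcomp Require Import mathcomp_extra boolp classical_sets functions.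
From mathcomp Require Import cardinality.
From mathcomp Require Import ring.

Import GRing.Theory.

Local Open Scope classical_set_scope.
Local Open Scope ring_scope.

(** Otherwise a choice of some [J] for each [t] would inject [T] into [C]. *)
Lemma card_pigeonhole (T U : Type) (C : set U) (P : T -> U -> Prop) :
  ~ ([set: T] #<= C)%card -> (forall t, exists J, C J /\ P t J) ->
  exists J s t, [/\ C J, s <> t, P s J & P t J].
Proof.
move=> ltCT /choice[f fP]; apply: contrapT => noJ; apply: ltCT.
have f_inj : {in [set: T] &, injective f}.
  move=> s t _ _ fst; apply: contrapT => st; apply: noJ.
  by exists (f s), s, t; have [? ?] := fP s; have [_] := fP t; rewrite -fst.
rewrite -(card_le_eql (inj_card_eq f_inj)); apply: subset_card_le.
by move=> _ [t _ <-]; have [] := fP t.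
Qed.

Lemma proper_ideal_lin {F : fieldType} {A : unitAlgType F} {J : set A}
    (a b : F) {x y : A} :
  proper_one_sided_ideal J -> J x -> J y -> J (a *: x - b *: y).
Proof.
have scale1 (c : F) (z : A) : c *: z = (c *: 1) * z by rewrite -scalerAl mul1r.
have scale2 (c : F) (z : A) : c *: z = z * (c *: 1) by rewrite -scalerAr mulr1.
case=> -[[_ JB JM]|[_ JB JM]] _ Jx Jy; apply: JB.
- by rewrite scale1; apply: JM.
- by rewrite scale1; apply: JM.
- by rewrite scale2; apply: JM.
- by rewrite scale2; apply: JM.
Qed.

Lemma proper_ideal_not1 {R : nzRingType} {J : set R} :
  proper_one_sided_ideal J -> ~ J 1.
Proof.
move=> [] JI JT J1; apply: JT; apply/seteqP; split=> // x _.
by case: JI => -[_ _ JM]; [rewrite -(mulr1 x)|rewrite -(mul1r x)]; apply: JM.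
Qed.

Section Directions.
Context (F : fieldType) (A : unitAlgType F) (C : set (set A)).
Context (T : Type) (g : T -> F * F).
Hypothesis ltCT : ~ ([set: T] #<= C)%card.
Hypothesis g_indep :
  forall s t, s <> t -> (g s).1 * (g t).2 - (g t).1 * (g s).2 != 0.
Hypothesis C_proper : forall J, C J -> proper_one_sided_ideal J.

(** Of the combinations of [x] and [y] with coefficients [g t], two with independent coefficients
    share an ideal of [C]. Taking for [Q] the membership of a further vector lets the argument be
    iterated. *)
Lemma common_ideal_span (Q : set A -> Prop) (x y : A) :
  (forall a b : F, exists J, C J /\ J (a *: x + b *: y) /\ Q J) ->
  exists J, [/\ C J, J x, J y & Q J].
Proof.
move=> H; pose P t J := J ((g t).1 *: x + (g t).2 *: y) /\ Q J.
have [] := @card_pigeonhole T _ C P ltCT.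
  by move=> t; apply: H.
move=> J [s [t [CJ st [Js QJ] [Jt _]]]]; exists J.
have JI := C_proper _ CJ.
move: Js Jt (g_indep _ _ st).
case: (g s) (g t) => [a b] [c d] /= Js Jt; set D := a * d - c * b => D0.
have comb (p q : F) : p *: (a *: x + b *: y) - q *: (c *: x + d *: y) =
    (p * a - q * c) *: x + (p * b - q * d) *: y.
  by rewrite !scalerDr !scalerA opprD addrACA -!scalerBl.
have Jcomb p q := proper_ideal_lin p q JI Js Jt.
split=> //.
(* Cramer's rule, with determinant [D], recovers [x] here and [y] below. *)
- have := Jcomb (d / D) (b / D); rewrite comb.
  have -> : d / D * a - b / D * c = 1 by rewrite /D; field.
  have -> : d / D * b - b / D * d = 0 by ring.
  by rewrite scale1r scale0r addr0.
- have := Jcomb (- c / D) (- a / D); rewrite comb.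
  have -> : - c / D * a - - a / D * c = 0 by ring.
  have -> : - c / D * b - - a / D * d = 1 by rewrite /D; field.
  by rewrite scale1r scale0r add0r.
Qed.

Lemma GKZ_algebra_directions : nonunits_covered_by C -> GKZ_algebra A.
Proof.
move=> [_ cover] L Lunit L1 x y.
have N_cover z : L z = 0 -> exists J, C J /\ J z.
  move=> Lz; have [J CJ Jz] : (\bigcup_(J in C) J) z; last by exists J.
  by apply: cover => /=; apply/negP => /Lunit; rewrite Lz eqxx.
have N_common2 u v : L u = 0 -> L v = 0 -> exists J, [/\ C J, J u & J v].
  move=> Lu Lv; have [] := @common_ideal_span (fun=> True) u v.
    move=> a b; have [|J [CJ Jw]] := N_cover (a *: u + b *: v); last by exists J.
    by rewrite linearD !linearZ /= Lu Lv !mulr0 addr0.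
  by move=> J [? ? ? _]; exists J.
have N_common3 u v w : L u = 0 -> L v = 0 -> L w = 0 ->
    exists J, [/\ C J, J u, J v & J w].
  move=> Lu Lv Lw; apply: common_ideal_span => a b.
  have [||J [CJ Ja Jw]] := N_common2 (a *: u + b *: v) w => //; last by exists J.
  by rewrite linearD !linearZ /= Lu Lv !mulr0 addr0.
have LC (c : F) : L (c *: 1) = c by rewrite linearZ /= L1 mulr1.
have N_mul u v : L u = 0 -> L v = 0 -> L (u * v) = 0.
  move=> Lu Lv; set c := L (u * v).
  have [||| J [CJ Ju Jv Jw]] := N_common3 u v (u * v - c *: 1) => //.
    by rewrite linearB /= LC subrr.
  have JI := C_proper _ CJ.
  (* A left ideal absorbs the product through [v], a right ideal through [u]. *)
  have Juv : J (u * v) by case: JI => -[] [_ _ JM] _; apply: JM.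
  apply/eqP/negP => /negP c0; apply: (proper_ideal_not1 JI).
  have := proper_ideal_lin c^-1 c^-1 JI Juv Jw.
  by rewrite -scalerBr opprB addrC subrK scalerA mulVf // scale1r.
(* Subtracting [L z *: 1] moves any [z] into the kernel, which reduces multiplicativity to
   [N_mul]. *)
have Lcenter z : L (z - L z *: 1) = 0 by rewrite linearB /= LC subrr.
have := N_mul _ _ (Lcenter x) (Lcenter y).
rewrite mulrBl !mulrBr -scalerAr -!scalerAl mulr1 !mul1r.
rewrite !linearB /= !linearZ /= L1 => /eqP.
by rewrite !mulr1 (mulrC (L y)) subrr subr0 subr_eq0 => /eqP.
Qed.

End Directions.

Theorem proposition2p15 (F : fieldType) (A : unitAlgType F) :
  [/\ (exists C : set (set A),
         (C #<= `I_2)%card /\ nonunits_covered_by C) ->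
      GKZ_algebra A,
      infinite_set [set: F] ->
      (exists C : set (set A),
         card_lt C [set: F] /\ nonunits_covered_by C) ->
      GKZ_algebra A
    & infinite_set [set: F] ->
      (exists C : set (set A),
         finite_set C /\ nonunits_covered_by C) ->
      GKZ_algebra A].
Proof.
have few_ideals (C : set (set A)) : ~ ([set: F] #<= C)%card ->
    nonunits_covered_by C -> GKZ_algebra A.
  move=> ltCF HC.
  (* The directions [(1, s)] and [(1, t)] have determinant [t - s]. *)
  apply: (@GKZ_algebra_directions _ _ C F (fun t => (1, t))) (HC) => //.
    move=> s t st /=; rewrite !mul1r subr_eq0.
    by apply/eqP => ts; apply: st.
  by case: HC.
split.
- move=> [C [leC2 HC]].
  (* The directions are [(1, 0)], [(0, 1)] and [(1, 1)], pairwise independent over every field. *)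
  apply: (@GKZ_algebra_directions _ _ C 'I_3
    (fun i => ((i != 1 :> nat)%:R, (i != 0 :> nat)%:R))) (HC) => //.
  + move=> le3C; have := card_le_trans le3C leC2.
    by rewrite -(card_le_eql (@card_II 3)) card_le_II.
  + move=> [[|[|[|//]]] si] [[|[|[|//]]] ti] st /=;
      rewrite ?(mulr0, mul0r, mulr1, subr0, sub0r, oppr_eq0, oner_eq0) //;
      by case: st; apply: val_inj.
  + by case: HC.
- by move=> _ [C [[_ ltCF] HC]]; apply: few_ideals HC.
- move=> Finf [C [Cfin HC]]; apply: few_ideals HC => leFC.
  by apply: Finf; apply: card_le_finite leFC Cfin.
Qed.
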